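(* Let $p\ge1$ be an integer. (i) If $p\le2$, then every NPRK method whose underlying coefficients $(a^{\{1\}},b^{\{1\}},c)$, $(a^{\{2\}},b^{\{2\}},c)$ satisfy the ARK order conditions to order $p$ satisfies the NPRK order conditions to order $p$. (ii) If $p\ge3$, this is false: satisfaction of the ARK order conditions to order $p$ by the underlying coefficients of an NPRK method is not sufficient for the NPRK method to satisfy the NPRK order conditions to order $p$; that is, there exists an NPRK method (with real coefficients, for some number of stages $s$) whose underlying coefficients satisfy the ARK order conditions to order $p$ but which does not satisfy the NPRK order conditions to order $p$.
   Context: **NPRK method and underlying coefficients.** An $s$-stage nonlinearly partitioned Runge--Kutta (NPRK) method for $y'=F(y,y)$ is given by real coefficients $a_{ijk}$, $b_{ij}$ ($i,j,k\in\{1,\dots,s\}$) via $Y_i=y_n+h\sum_{j,k}a_{ijk}F(Y_j,Y_k)$, $y_{n+1}=y_n+h\sum_{i,j}b_{ij}F(Y_i,Y_j)$. Its underlying coefficients are $$a^{\{1\}}_{ij}=\sum_{k=1}^sa_{ijk},\quad b^{\{1\}}_i=\sum_{j=1}^sb_{ij},\quad a^{\{2\}}_{ik}=\sum_{j=1}^sa_{ijk},\quad b^{\{2\}}_j=\sum_{i=1}^sb_{ij},\quad c_i=\sum_ja^{\{1\}}_{ij}=\sum_ka^{\{2\}}_{ik}.$$ They are the coefficients of the additive Runge--Kutta (ARK) method to which the NPRK method reduces when $F(u,v)=F^{\{1\}}(u)+F^{\{2\}}(v)$. **NPRK order conditions.** Edge-colored rooted trees are finite rooted trees with each edge colored in $\{1,2\}$: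 $\bullet$ is the single node, and $\tau=[\tau_1|_{a_1},\dots,\tau_m|_{a_m}]$ is the tree obtained by joining the roots of $\tau_1,\dots,\tau_m$ to a new root by edges of colors $a_1,\dots,a_m\in\{1,2\}$ respectively. Let $|\tau|$ be the number of nodes; $\gamma(\bullet)=1$, $\gamma(\tau)=|\tau|\gamma(\tau_1)\cdots\gamma(\tau_m)$. Set $\phi_{i_1i_2}(\bullet)=1$, $\phi_{i_1i_2}(\tau)=\prod_{l=1}^m\sum_{u,v=1}^sa_{i_{a_l}uv}\phi_{uv}(\tau_l)$, and $\Phi(\tau)=\sum_{i,j}b_{ij}\phi_{ij}(\tau)$. The NPRK order conditions to order $p$ are: $\Phi(\tau)=1/\gamma(\tau)$ for all edge-colored rooted trees with $|\tau|\le p$. **ARK order conditions.** For node-colored rooted trees (finite rooted trees with each node, including the root, colored in $\{1,2\}$), let $\gamma$ be the density defined by the recursion $\gamma(\rho)=1$ if $\rho$ is a single node (of either color), and $\gamma(\rho)=|\rho|\gamma(\rho_1)\cdots\gamma(\rho_m)$ if $\rho$ has root subtrees $\rho_1,\dots,\rho_m$ (the trees obtained by removing the root of $\rho$ and the edges attached to it), where $|\rho|$ is the number of nodes of $\rho$. For a node-colored tree $\rho$ with root subtrees $\rho_1,\dots,\rho_m$ whose roots have colors $r_1,\dots,r_m$, set $\psi_i(\rho)=\prod_{l=1}^m\sum_{j=1}^sa^{\{r_l\}}_{ij}\psi_j(\rho_l)$ (an empty product, for a single node, being $1$). The ARK order conditions to order $p$ are: $\sum_{i=1}^sb^{\{r\}}_i\psi_i(\rho)=1/\gamma(\rho)$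 for all node-colored rooted trees $\rho$ with at most $p$ nodes, where $r$ is the color of the root of $\rho$. *)

(* Defs.v *)
From HB Require Import structures.
From mathcomp Require Import all_boot all_order all_algebra.
From mathcomp Require Import reals.
Set Implicit Arguments.
Unset Strict Implicit.
Unset Printing Implicit Defensive.
Import Order.TTheory GRing.Theory Num.Theory.
Local Open Scope ring_scope.

Inductive color := Col1 | Col2.

(* A method is identified with its coefficients: for y' = F(y, y),
     Y_i     = y_n + h \sum_(j, k) a_ijk F(Y_j, Y_k),
     y_(n+1) = y_n + h \sum_(i, j) b_ij  F(Y_i, Y_j).
   The s stages are indexed from 0 by 'I_s. *)
Record nprk (R : realType) (s : nat) := Nprk {
  nprk_a : 'I_s -> 'I_s -> 'I_s -> R;
  nprk_b : 'I_s -> 'I_s -> R }.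

Record rk_tableau (R : realType) (s : nat) := RkTableau {
  rk_a : 'I_s -> 'I_s -> R;
  rk_b : 'I_s -> R;
  rk_c : 'I_s -> R }.

Definition underlying_a (R : realType) (s : nat) (M : nprk R s) (r : color)
    (i j : 'I_s) : R :=
  match r with
  | Col1 => \sum_(k < s) nprk_a M i j k
  | Col2 => \sum_(k < s) nprk_a M i k j
  end.

Definition underlying_b (R : realType) (s : nat) (M : nprk R s) (r : color)
    (i : 'I_s) : R :=
  match r with
  | Col1 => \sum_(j < s) nprk_b M i j
  | Col2 => \sum_(j < s) nprk_b M j i
  end.

Definition underlying_c (R : realType) (s : nat) (M : nprk R s) (r : color)
    (i : 'I_s) : R :=
  \sum_(j < s) underlying_a M r i j.

Lemma underlying_cE (R : realType) (s : nat) (M : nprk R s) (i : 'I_s) :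
  underlying_c M Col1 i = underlying_c M Col2 i.
Proof. exact: exchange_big. Qed.

(* An additive Runge-Kutta method with two parts is a pair of tableaux,
   encoded as a function of the color. *)
Definition underlying (R : realType) (s : nat) (M : nprk R s) (r : color) :
    rk_tableau R s :=
  RkTableau (underlying_a M r) (underlying_b M r) (underlying_c M r).

(* Trees below carry an order on the children of each node.  Every rooted tree
   has such a representation, and size, density and elementary weights do not
   depend on the order, so quantifying over ordered trees amounts to
   quantifying over rooted trees. *)

(* [ENode [:: (t1, a1); ...; (tm, am)]] is [t1|_a1, ..., tm|_am]: the color
   paired with a subtree is that of the edge joining it to the root. *)
Inductive etree := ENode of seq (etree * color).

Fixpoint esize (t : etree) : nat :=
  let: ENode l := t in (sumn [seq esize x.1 | x <- l]).+1.

(* For the single node the formula gives 1 * 1. *)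
Fixpoint edensity (t : etree) : nat :=
  let: ENode l := t in
  (esize t * \prod_(g <- [seq edensity x.1 | x <- l]) g)%N.

Definition select (T : Type) (r : color) (x1 x2 : T) : T :=
  match r with Col1 => x1 | Col2 => x2 end.

Fixpoint nprk_phi (R : realType) (s : nat) (M : nprk R s) (t : etree)
    (i1 i2 : 'I_s) {struct t} : R :=
  let: ENode l := t in
  \prod_(z <- [seq \sum_(u < s) \sum_(v < s)
                     nprk_a M (select x.2 i1 i2) u v * nprk_phi M x.1 u v
              | x <- l]) z.

Definition nprk_weight (R : realType) (s : nat) (M : nprk R s) (t : etree) : R :=
  \sum_(i < s) \sum_(j < s) nprk_b M i j * nprk_phi M t i j.

Definition nprk_order_conditions (R : realType) (s : nat) (M : nprk R s)
    (p : nat) : Prop :=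
  forall t : etree, (esize t <= p)%N -> nprk_weight M t = 1 / (edensity t)%:R.

(* [NNode r [:: t1; ...; tm]] has a root of color r and root subtrees ti. *)
Inductive ntree := NNode of color & seq ntree.

Definition root_color (t : ntree) : color := let: NNode r _ := t in r.

Fixpoint nsize (t : ntree) : nat :=
  let: NNode _ l := t in (sumn [seq nsize x | x <- l]).+1.

Fixpoint ndensity (t : ntree) : nat :=
  let: NNode _ l := t in
  (nsize t * \prod_(g <- [seq ndensity x | x <- l]) g)%N.

Fixpoint ark_psi (R : realType) (s : nat) (T : color -> rk_tableau R s)
    (t : ntree) (i : 'I_s) {struct t} : R :=
  let: NNode _ l := t in
  \prod_(z <- [seq \sum_(j < s) rk_a (T (root_color x)) i j * ark_psi T x j
              | x <- l]) z.

(* The abscissae rk_c do not enter: only a and b occur in these conditions. *)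
Definition ark_order_conditions (R : realType) (s : nat)
    (T : color -> rk_tableau R s) (p : nat) : Prop :=
  forall t : ntree, (nsize t <= p)%N ->
    \sum_(i < s) rk_b (T (root_color t)) i * ark_psi T t i
      = 1 / (ndensity t)%:R.

(* Main.v *)
Require Import Defs.
From mathcomp Require Import all_boot all_order all_algebra.
From mathcomp Require Import reals.
Set Implicit Arguments.
Unset Strict Implicit.
Unset Printing Implicit Defensive.
Import Order.TTheory GRing.Theory Num.Theory.
Local Open Scope ring_scope.

(** For order at most 2, the only edge-colored trees are the single node and
    the two trees with one edge.  Their weights use the indices of [b] and [a]
    one at a time, so they are sums of underlying coefficients and coincide
    with ARK weights (lemma [nprk_order2]).

    From order 3 on, the tree [cherry] with two leaves joined to the root by
    edges of different colors has weight [\sum_(i, j) b_ij c_i c_j], which the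
    marginals of [b] do not determine.  Given a Runge-Kutta method [(A, b)] of
    order [p], the [product_method] [a_ijk = A_ij] if [j = k] and [0]
    otherwise, [b_ij = b_i b_j], has [(A, b)] as both of its underlying
    methods because [\sum_i b_i = 1], so the ARK conditions hold; but the weight of [cherry] is
    [(\sum_i b_i c_i)^2 = 1/4] instead of [1/3].

    Runge-Kutta methods of every order [p] exist by collocation at [p] distinct
    nodes: requiring the quadratures given by [b] and by the rows of [A] to be
    exact on polynomials of degree less than [p] is a Vandermonde system
    ([quadrature_exists]).  Exactness makes the stage weights of a tree with
    [n] nodes the monomial of degree [n - 1] in the node, up to the factor
    [n / gamma] ([ark_psi_collocation]), and then [b] integrates this monomial
    exactly ([ark_order_collocation]). *)

Lemma nprk_order2 (R : realType) (s : nat) (M : nprk R s) (p : nat) :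
  (p <= 2)%N -> ark_order_conditions (underlying M) p ->
  nprk_order_conditions M p.
Proof.
move=> p2 ark [[|[[l'] r] l]] tp.
  have /= := ark (NNode Col1 [::]) tp.
  rewrite /nprk_weight /= big_nil => <-.
  apply: eq_bigr => i _; rewrite mulr1.
  by apply: eq_bigr => j _; rewrite mulr1.
(* Two nodes are already present, hence both remaining lists are empty. *)
have [l'0 l0] : l' = [::] /\ l = [::].
  move: (leq_trans tp p2).
  by case: l' l {tp} => [|[[?] ?] ?] [|[[?] ?] ?]; rewrite //= ?addSn !ltnS ltn0.
rewrite {}l'0 {}l0 in tp *.
have {tp} := ark (NNode r [:: NNode r [::]]) tp.
rewrite /nprk_weight /= !big_seq1 !big_nil => <-.
case: r => /=; last rewrite exchange_big /=;
  apply: eq_bigr => i _; rewrite big_distrl; apply: eq_bigr => j _;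
  rewrite !big_seq1; congr (_ * _); last rewrite exchange_big /=;
  apply: eq_bigr => u _; rewrite mulr1;
  by apply: eq_bigr => v _; rewrite mulr1.
Qed.

(** The right-hand side is the integral over [[0, y]] of the monomial of degree
    [k]; the matrix of this linear system in [w] is the Vandermonde matrix of
    the nodes [c], invertible because they are distinct. *)
Lemma quadrature_exists (F : numFieldType) (p : nat) (c : 'I_p -> F) :
  injective c ->
  forall y : F, exists w : 'I_p -> F, forall k, (k < p)%N ->
    \sum_(j < p) w j * c j ^+ k = y ^+ k.+1 / k.+1%:R.
Proof.
move=> c_inj y.
pose V := Vandermonde p (\row_(j < p) c j).
have Vu : V \in unitmx.
  rewrite unitmxE det_Vandermonde unitfE.
  apply/prodf_neq0 => i _; apply/prodf_neq0 => j ltij.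
  rewrite !mxE subr_eq0; apply: contraTneq ltij => /c_inj ->.
  by rewrite ltnn.
pose z := \col_(k < p) (y ^+ k.+1 / k.+1%:R).
exists (fun j => (invmx V *m z) j ord0) => k ltkp.
have := congr1 (fun N : 'cV_p => N (Ordinal ltkp) ord0) (mulKVmx Vu z).
rewrite !mxE => <-; apply: eq_bigr => j _.
by rewrite !mxE /= mulrC.
Qed.

(** The induction hypothesis turns each factor [\sum_j a_ij psi_j] into the
    integral of a monomial, of degree less than [q] because a proper subtree
    is smaller; the exponents then add up to the number of non-root nodes. *)
Lemma ark_psi_collocation (R : realType) (s : nat) (T : color -> rk_tableau R s)
    (c : 'I_s -> R) (q : nat) :
  (forall r i k, (k < q)%N ->
    \sum_(j < s) rk_a (T r) i j * c j ^+ k = c i ^+ k.+1 / k.+1%:R) ->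
  forall t i, (nsize t <= q.+1)%N ->
    ark_psi T t i = (nsize t)%:R * c i ^+ (nsize t).-1 / (ndensity t)%:R.
Proof.
move=> exactA t; move: {2}(nsize t) (leqnn (nsize t)) => n.
elim: n t => [|n IHn] [r l] // le_n i le_q.
suff -> : ark_psi T (NNode r l) i =
    c i ^+ sumn [seq nsize x | x <- l]
    / (\prod_(g <- [seq ndensity x | x <- l]) g)%:R.
  by rewrite /= natrM invfM [_%:R * _]mulrC mulrA mulfK ?pnatr_eq0.
move: le_n le_q; rewrite /= !ltnS.
elim: l => [|t l IHl] /= le_n le_q; first by rewrite !big_nil expr0 divr1.
rewrite !big_cons IHl ?(leq_trans _ le_n) ?(leq_trans _ le_q) ?leq_addl //.
have t_n : (nsize t <= n)%N by apply: leq_trans le_n; apply: leq_addr.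
have t_q : (nsize t <= q)%N by apply: leq_trans le_q; apply: leq_addr.
under eq_bigr => j _ do rewrite IHn ?(leqW t_q) // [_ * c j ^+ _]mulrC !mulrA.
have t_gt0 : (0 < nsize t)%N by case: (t).
rewrite -2!mulr_suml exactA ?prednK // divfK ?pnatr_eq0 -?lt0n //.
by rewrite exprD natrM invfM mulrACA.
Qed.

(** By [ark_psi_collocation] the weight of a tree with [n] nodes is
    [n / gamma] times the quadrature of [c ^ (n - 1)], which is [1 / n]. *)
Lemma ark_order_collocation (R : realType) (s : nat)
    (T : color -> rk_tableau R s) (c : 'I_s -> R) (q : nat) :
  (forall r i k, (k < q)%N ->
    \sum_(j < s) rk_a (T r) i j * c j ^+ k = c i ^+ k.+1 / k.+1%:R) ->
  (forall r k, (k < q)%N ->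
    \sum_(j < s) rk_b (T r) j * c j ^+ k = 1 / k.+1%:R) ->
  ark_order_conditions T q.
Proof.
move=> exactA exactb t t_q.
under eq_bigr => i _.
  rewrite (ark_psi_collocation exactA) ?(leqW t_q) //.
  rewrite [_ * c i ^+ _]mulrC !mulrA; over.
have t_gt0 : (0 < nsize t)%N by case: (t).
by rewrite -2!mulr_suml exactb ?prednK // divfK ?pnatr_eq0 -?lt0n.
Qed.

(** The two indices of [a] are tied together and those of [b] are independent:
    the marginals are [A] and, when [\sum_i b_i = 1], [b]; the second choice
    makes the stages of the two arguments of [F] uncorrelated in the last
    step. *)
Definition product_method (R : realType) (s : nat) (A : 'I_s -> 'I_s -> R)
    (b : 'I_s -> R) : nprk R s :=
  Nprk (fun i j k => A i j *+ (j == k)) (fun i j => b i * b j).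

Lemma product_method_a (R : realType) (s : nat) (A : 'I_s -> 'I_s -> R)
    (b : 'I_s -> R) (r : color) (i j : 'I_s) :
  underlying_a (product_method A b) r i j = A i j.
Proof.
case: r => /=; rewrite (bigD1 j) //= eqxx mulr1n big1 ?addr0 // => k.
  by rewrite eq_sym => /negbTE ->.
by move=> /negbTE ->.
Qed.

Lemma product_method_b (R : realType) (s : nat) (A : 'I_s -> 'I_s -> R)
    (b : 'I_s -> R) (r : color) (i : 'I_s) :
  \sum_(j < s) b j = 1 -> underlying_b (product_method A b) r i = b i.
Proof.
by case: r => b1 /=; rewrite -?mulr_sumr -?mulr_suml b1 ?mulr1 ?mul1r.
Qed.

Definition cherry : etree :=
  ENode [:: (ENode [::], Col1); (ENode [::], Col2)].

(** Each leaf contributes the abscissa of one of the two root stages, and the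
    double sum of [b_i b_j c_i c_j] factors. *)
Lemma product_method_cherry (R : realType) (s : nat) (A : 'I_s -> 'I_s -> R)
    (b : 'I_s -> R) :
  nprk_weight (product_method A b) cherry =
  (\sum_(i < s) b i * \sum_(j < s) A i j) ^+ 2.
Proof.
have leaf i : \sum_(u < s) \sum_(v < s)
    nprk_a (product_method A b) i u v * nprk_phi (product_method A b)
      (ENode [::]) u v = \sum_(j < s) A i j.
  apply: eq_bigr => j _; rewrite -(product_method_a A b Col1 i j).
  by apply: eq_bigr => k _; rewrite /= big_nil mulr1.
rewrite expr2 mulr_suml; apply: eq_bigr => i _.
rewrite mulr_sumr; apply: eq_bigr => j _.
rewrite -mulrACA -!leaf /=; congr (_ * _).
by rewrite big_cons big_seq1.
Qed.

Local Close Scope ring_scope.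

Theorem mainTheorem5 (R : realType) (p : nat) (hp : 1 <= p) :
  (p <= 2 ->
     forall (s : nat) (M : nprk R s),
       ark_order_conditions (underlying M) p -> nprk_order_conditions M p)
  /\
  (3 <= p ->
     exists (s : nat) (M : nprk R s),
       ark_order_conditions (underlying M) p /\ ~ nprk_order_conditions M p).
Proof.
split=> [p2 s M|p3]; first exact: nprk_order2.
pose c (i : 'I_p) : R := (i%:R)%R.
have c_inj : injective c.
  by move=> i j /eqP; rewrite /c eqr_nat => /eqP /val_inj.
have [b exactb] := quadrature_exists c_inj 1%R.
have [A exactA] : exists A : 'I_p -> 'I_p -> R, forall i k, k < p ->
    (\sum_(j < p) A i j * c j ^+ k = c i ^+ k.+1 / k.+1%:R)%R.
  exact: fin_all_exists (fun i => quadrature_exists c_inj (c i)).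
have b1 : (\sum_(j < p) b j = 1)%R.
  have /= := exactb 0 hp; rewrite expr1n divr1 => <-.
  by apply: eq_bigr => j _; rewrite expr0 mulr1.
exists p, (product_method A b); split.
  apply: (@ark_order_collocation _ _ _ c) => [r i|r] k k_p.
    rewrite -exactA //; apply: eq_bigr => j _.
    by rewrite /= product_method_a.
  have := exactb k k_p; rewrite expr1n => <-; apply: eq_bigr => j _.
  by rewrite /= product_method_b.
move=> /(_ cherry p3).
have c_sum i : (\sum_(j < p) A i j = c i)%R.
  have /= := exactA i 0 hp; rewrite expr1 divr1 => <-.
  by apply: eq_bigr => j _; rewrite expr0 mulr1.
rewrite product_method_cherry; under eq_bigr => i _ do rewrite c_sum.
have /= := exactb 1 (ltnW p3).
under eq_bigr => i _ do rewrite expr1.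
rewrite expr1n => ->; rewrite /= !big_cons !big_nil !muln1.
(* What remains is (1 / 2) ^ 2 = 1 / 3; inverting both sides gives 4 = 3. *)
move=> /(congr1 (fun x : R => x^-1)%R) /eqP.
by rewrite !div1r exprVn !invrK -natrX eqr_nat.
Qed.
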